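(* Let $1\le k\le n$. Then $$d_{\mathrm{cb}}(H_n^k,H_n^n)=\sqrt{\frac{(n-k+1)n}{k}}.$$
   Context: Definition of $H_n^k$. Let $1\le k\le n$. Let $I=\{i_1<\cdots<i_{k-1}\}$ range over the subsets of $\{1,\ldots,n\}$ of cardinality $k-1$ (there are $q=\binom{n}{k-1}$ of them) and $J=\{j_1<\cdots<j_{n-k}\}$ over the subsets of cardinality $n-k$ (there are $p=\binom{n}{n-k}$ of them), each collection ordered lexicographically. Let $\{e_I\}$ and $\{e_J\}$ be the canonical bases of column vectors of $\mathbf{C}^q$ and $\mathbf{C}^p$, indexed by these subsets, and let $e_{J,I}=e_Je_I^t\in M_{p,q}(\mathbf{C})=B(\mathbf{C}^q,\mathbf{C}^p)$. For $1\le i\le n$ put $$b_i^{n,k}=\sum_{I\cap J=\emptyset,\ (I\cup J)^c=\{i\}}\epsilon(I,i,J)\,e_{J,I},$$ where $\epsilon(I,i,J)$ is the signature of the permutation taking $(i_1,\ldots,i_{k-1},i,j_1,\ldots,j_{n-k})$ to $(1,\ldots,n)$. Then $H_n^k$ is the linear span of $b_1^{n,k},\ldots,b_n^{n,k}$, with the operator space structure inherited from $B(\mathbf{C}^q,\mathbf{C}^p)$. In particular $H_n^1=B(\mathbf{C},\mathbf{C}^n)$ is the column Hilbert space $C_n$ and $H_n^n=B(\mathbf{C}^n,\mathbf{C})$ is the row Hilbert space $R_n$. The completely bounded Banach-Mazur distance between completely isomorphic operator spaces $E,F$ is $d_{\mathrm{cb}}(E,F)=\inf\{\|u\|_{\mathrm{cb}}\|u^{-1}\|_{\mathrm{cb}}\}$,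 the infimum being over all complete isomorphisms $u:E\to F$ (linear bijections with $u$ and $u^{-1}$ completely bounded). *)

(* Defs.v *)
From HB Require Import structures.
From mathcomp Require Import all_boot all_order all_algebra perm.
From mathcomp Require Import all_classical all_reals ereal.
From mathcomp Require Import complex.

Set Implicit Arguments.
Unset Strict Implicit.
Unset Printing Implicit Defensive.

Import Order.TTheory GRing.Theory Num.Theory.

Import ComplexField.Normc.

Local Open Scope ring_scope.
Local Open Scope complex_scope.

Section OperatorSpaces.
Local Open Scope classical_set_scope.
Variable R : realType.
Local Notation C := R[i].

Definition l2norm (q : nat) (v : 'cV[C]_q) : R :=
  Num.sqrt (\sum_(i < q) normc (v i 0) ^+ 2).

(* The set is nonempty (v = 0) and bounded above, so its real-valued [sup] is
   a genuine supremum. *)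
Definition opnorm (p q : nat) (A : 'M[C]_(p, q)) : R :=
  sup [set l2norm (A *m v) | v in [set v : 'cV[C]_q | l2norm v <= 1]].

(* A subspace E of 'M_(p, q) = B(C^q, C^p) carries the inherited operator
   space structure: an m x m matrix with entries in E is normed as an operator
   from (C^q)^m to (C^p)^m. *)
Definition block (p q : nat) (E : {vspace 'M[C]_(p, q)}) (m : nat)
    (x : 'M[subvs_of E]_m) : 'M[C]_(\sum_(i < m) p, \sum_(j < m) q) :=
  @mxblock C m m (fun=> p) (fun=> q) (fun i j => vsval (x i j)).

Definition matnorm (p q : nat) (E : {vspace 'M[C]_(p, q)}) (m : nat)
    (x : 'M[subvs_of E]_m) : R := opnorm (block x).

Section MapsBetween.
Variables (p q r s : nat).
Variables (E : {vspace 'M[C]_(p, q)}) (F : {vspace 'M[C]_(r, s)}).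

Definition ampnorm (u : 'Hom(subvs_of E, subvs_of F)) (m : nat) : \bar R :=
  ereal_sup [set (matnorm (map_mx u x))%:E
            | x in [set x : 'M[subvs_of E]_m | matnorm x <= 1]].

Definition cbnorm (u : 'Hom(subvs_of E, subvs_of F)) : \bar R :=
  ereal_sup [set ampnorm u m | m in [set m : nat | (0 < m)%N]].

Definition completely_bounded (u : 'Hom(subvs_of E, subvs_of F)) : Prop :=
  (cbnorm u < +oo)%E.

End MapsBetween.

Definition complete_isomorphism (p q r s : nat)
    (E : {vspace 'M[C]_(p, q)}) (F : {vspace 'M[C]_(r, s)})
    (u : 'Hom(subvs_of E, subvs_of F)) (v : 'Hom(subvs_of F, subvs_of E)) :=
  [/\ cancel u v, cancel v u, completely_bounded u & completely_bounded v].

(* The infimum of the empty set is +oo, so a finite value of [dcb E F] entails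
   that E and F are completely isomorphic. *)
Definition dcb (p q r s : nat)
    (E : {vspace 'M[C]_(p, q)}) (F : {vspace 'M[C]_(r, s)}) : \bar R :=
  ereal_inf [set d : \bar R | exists u v,
    complete_isomorphism (E := E) (F := F) u v /\ d = (cbnorm u * cbnorm v)%E].

End OperatorSpaces.

Section HomogeneousSpaces.
Variable n : nat.

(* Subsets of 'I_n (0-based in place of {1, ..., n}) of cardinality m in
   lexicographic order; [enum A] lists A increasingly. *)
Definition subsets (m : nat) : seq {set 'I_n} :=
  sort (fun A B : {set 'I_n} =>
          (map val (enum A) : seqlexi nat) <= map val (enum B))%O
       (enum [set A : {set 'I_n} | #|A| == m]%SET).

Definition subset_at (m : nat) (a : 'I_('C(n, m))) : {set 'I_n} :=
  nth finset.set0 (subsets m) a.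

(* The permutation taking the word (I, i, J) to the increasing word; it exists
   and is unique when I, {i}, J partition 'I_n, the only case used below. *)
Definition word_perm (I : {set 'I_n}) (i : 'I_n) (J : {set 'I_n}) : 'S_n :=
  odflt 1%g [pick s : 'S_n | map s (enum I ++ i :: enum J) == enum 'I_n].

Variable R : realType.

Definition bmx (k : nat) (i : 'I_n) : 'M[R[i]]_('C(n, n - k), 'C(n, k.-1)) :=
  \sum_(c < 'C(n, k.-1)) \sum_(r < 'C(n, n - k)
      | (subset_at c :&: subset_at r == finset.set0)%SET &&
        (~: (subset_at c :|: subset_at r) == [set i])%SET)
    (-1) ^+ word_perm (subset_at c) i (subset_at r) *: delta_mx r c.

Definition Hspace (k : nat) : {vspace 'M[R[i]]_('C(n, n - k), 'C(n, k.-1))} :=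
  <<[seq bmx k i | i <- enum 'I_n]>>%VS.

End HomogeneousSpaces.

(* Main.v *)
From HB Require Import structures.
Require Import Defs.
From mathcomp Require Import all_boot all_order all_algebra perm.
From mathcomp Require Import all_classical all_reals ereal.
From mathcomp Require Import complex ring.

(* Only three facts about the b_i of H_n^k matter; the signs drop out of all of
   them: sum b_i^* b_i = n - k + 1, sum b_i b_i^* = k, and the b_i are
   orthogonal for the trace, with common square norm N = 'C(n - 1, k - 1).

   The map b_i <-> c_i onto the row space H_n^n realizes the distance.
   Factoring sum_t a_t (x) b_t as the row of the a_t times the column of the
   b_t gives norm at most sqrt (n - k + 1) from the row space, and applying the
   trace state to (sum_t a_t (x) b_t)(sum_t a_t (x) b_t)^* gives norm at most
   sqrt (n / k) towards it.

   Conversely, let u map H_n^k onto the row space, with matrix U in these bases,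
   and let V be the matrix of u^-1. Testing u on the row (b_1, ..., b_n), of
   norm at most sqrt k, gives |u|_cb^2 >= |U|_HS^2 / k; testing u^-1 on the
   column (c_1, ..., c_n), of norm at most 1, gives
   |u^-1|_cb^2 >= |V|_HS^2 (n - k + 1) / n. Finally |U|_HS |V|_HS >= tr(UV) = n
   by Cauchy-Schwarz. *)

Set Implicit Arguments.
Unset Strict Implicit.
Unset Printing Implicit Defensive.

Import Order.TTheory GRing.Theory Num.Theory.
Import ComplexField.Normc.
Local Open Scope ring_scope.
Local Open Scope complex_scope.

(** * Hilbert-Schmidt norms, and the operator norm tested against them *)

Section HilbertSchmidt.
Variable R : realType.
Local Notation C := R[i].

(** Lagrange's identity: the double sum of the squares (x_i y_j - x_j y_i)^2 is twice the difference
    of the two sides. *)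
Lemma sum_sqr_CauchySchwarz (I : finType) (x y : I -> R) :
  (\sum_i x i * y i) ^+ 2 <= (\sum_i x i ^+ 2) * (\sum_i y i ^+ 2).
Proof.
have: 0 <= \sum_i \sum_j (x i * y j - x j * y i) ^+ 2.
  by apply: sumr_ge0 => i _; apply: sumr_ge0 => j _; apply: sqr_ge0.
have -> : \sum_i \sum_j (x i * y j - x j * y i) ^+ 2 =
    \sum_i \sum_j x i ^+ 2 * y j ^+ 2 + \sum_i \sum_j x j ^+ 2 * y i ^+ 2
    - (\sum_i \sum_j (x i * y i) * (x j * y j)) *+ 2.
  rewrite -sumrMnl -big_split -sumrB /=; apply: eq_bigr => i _.
  rewrite -sumrMnl -big_split -sumrB /=; apply: eq_bigr => j _.
  by ring.
rewrite [X in _ + X - _]exchange_big /= -mulr2n -mulrnBl pmulrn_lge0 //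
  subr_ge0.
by move=> h; rewrite expr2 !big_distrlr.
Qed.

Lemma normC_real (z : C) : (normc z)%:C = `|z|.
Proof. by []. Qed.

Lemma normc_ge0 (z : C) : 0 <= normc z.
Proof. by rewrite -(@lecR R) normC_real normr_ge0. Qed.

Lemma normc_sqr (z : C) : (normc z ^+ 2)%:C = Num.conj z * z.
Proof. by rewrite rmorphXn /= normC_real normCK mulrC. Qed.

Lemma normc_real_sqr (a : R) : normc a%:C ^+ 2 = a ^+ 2.
Proof. by rewrite /normc /= expr0n addr0 sqr_sqrtr ?sqr_ge0. Qed.

Lemma normc_sum_CauchySchwarz (I : finType) (x y : I -> C) :
  normc (\sum_i x i * y i) ^+ 2 <=
  (\sum_i normc (x i) ^+ 2) * (\sum_i normc (y i) ^+ 2).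
Proof.
apply: le_trans _ (sum_sqr_CauchySchwarz _ _).
rewrite ler_sqr ?nnegrE ?normc_ge0 //.
  rewrite -(@lecR R) normC_real rmorph_sum /=.
  by apply: le_trans (ler_norm_sum _ _ _) _; apply: ler_sum => i _;
    rewrite rmorphM /= !normC_real normrM.
by apply: sumr_ge0 => i _; rewrite mulr_ge0 ?normc_ge0.
Qed.

Definition adjm m n (A : 'M[C]_(m, n)) : 'M[C]_(n, m) := (map_mx Num.conj A)^T.

(** The squared Hilbert-Schmidt norm, which on a column is the squared l2 norm. Keeping the square
    makes it additive over blocks. *)
Definition hs m n (A : 'M[C]_(m, n)) : R := \sum_i \sum_j normc (A i j) ^+ 2.

(** Real identities about [hs] are proved below by embedding them in C through [complexI] and
    computing with traces. *)
Lemma hsE m n (A : 'M[C]_(m, n)) : (hs A)%:C = \tr (adjm A *m A).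
Proof.
rewrite /hs rmorph_sum /= /mxtrace.
under [RHS]eq_bigr do rewrite mxE.
rewrite [RHS]exchange_big /=; apply: eq_bigr => i _.
by rewrite rmorph_sum /=; apply: eq_bigr => j _; rewrite normc_sqr !mxE.
Qed.

Lemma hs_ge0 m n (A : 'M[C]_(m, n)) : 0 <= hs A.
Proof. by apply: sumr_ge0 => i _; apply: sumr_ge0 => j _; apply: sqr_ge0. Qed.

Lemma adjm_mul m n p (A : 'M[C]_(m, n)) (B : 'M[C]_(n, p)) :
  adjm (A *m B) = adjm B *m adjm A.
Proof. by rewrite /adjm map_mxM trmx_mul. Qed.

Lemma adjmK m n (A : 'M[C]_(m, n)) : adjm (adjm A) = A.
Proof. by apply/matrixP => i j; rewrite !mxE conjCK. Qed.

Lemma adjmD m n (A B : 'M[C]_(m, n)) : adjm (A + B) = adjm A + adjm B.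
Proof. by rewrite /adjm map_mxD linearD. Qed.

Lemma adjmN m n (A : 'M[C]_(m, n)) : adjm (- A) = - adjm A.
Proof. by rewrite /adjm map_mxN linearN. Qed.

Lemma adjmZ m n a (A : 'M[C]_(m, n)) : adjm (a *: A) = Num.conj a *: adjm A.
Proof. by rewrite /adjm map_mxZ linearZ. Qed.

Lemma adjm_sum m n (I : finType) (A : I -> 'M[C]_(m, n)) :
  adjm (\sum_i A i) = \sum_i adjm (A i).
Proof. by rewrite /adjm raddf_sum /= raddf_sum. Qed.

Lemma hs_tr m n (A : 'M[C]_(m, n)) : hs A^T = hs A.
Proof.
rewrite /hs exchange_big; apply: eq_bigr => i _.
by apply: eq_bigr => j _; rewrite mxE.
Qed.

Lemma hs_adj m n (A : 'M[C]_(m, n)) : hs (adjm A) = hs A.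
Proof. by apply: (@complexI R); rewrite !hsE adjmK mxtrace_mulC. Qed.

Lemma hsZ m n a (A : 'M[C]_(m, n)) : hs (a *: A) = normc a ^+ 2 * hs A.
Proof.
apply: (@complexI R); rewrite rmorphM /= !hsE normc_sqr adjmZ -scalemxAl
  -scalemxAr.
by rewrite !linearZ /= mulrA.
Qed.

Lemma hs0 m n : hs (0 : 'M[C]_(m, n)) = 0.
Proof. by apply: (@complexI R); rewrite hsE mulmx0 linear0. Qed.

Lemma hs_cols m n (A : 'M[C]_(m, n)) : hs A = \sum_j hs (col j A).
Proof.
rewrite /hs exchange_big; apply: eq_bigr => j _; apply: eq_bigr => i _.
by rewrite big_ord1 mxE.
Qed.

Lemma hs_mxcol m (p_ : 'I_m -> nat) n (A : forall i, 'M[C]_(p_ i, n)) :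
  hs (\mxcol_i A i) = \sum_i hs (A i).
Proof.
apply: (@complexI R); rewrite hsE rmorph_sum /=.
have -> : adjm (\mxcol_i A i) = \mxrow_i adjm (A i).
  by apply/matrixP => i j; rewrite !mxE.
rewrite mul_mxrow_mxcol raddf_sum /=; apply: eq_bigr => i _.
by rewrite hsE.
Qed.

Lemma hs_mul m n p (A : 'M[C]_(m, n)) (B : 'M[C]_(n, p)) :
  hs (A *m B) <= hs A * hs B.
Proof.
rewrite /hs [X in _ * X]exchange_big big_distrl /=; apply: ler_sum => i _.
rewrite big_distrr /=; apply: ler_sum => j _.
by rewrite mxE normc_sum_CauchySchwarz.
Qed.

(** Cauchy-Schwarz of the diagonal against the constant 1, after which the off-diagonal squares are
    added. *)
Lemma normc_trace n (A : 'M[C]_n) : normc (\tr A) ^+ 2 <= n%:R * hs A.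
Proof.
have -> : \tr A = \sum_i 1 * A i i by apply: eq_bigr => i _; rewrite mul1r.
apply: le_trans (normc_sum_CauchySchwarz _ _) _.
have -> : \sum_(i < n) normc (1 : C) ^+ 2 = n%:R.
  by rewrite normc1 expr1n sumr_const card_ord.
rewrite ler_wpM2l ?ler0n //; apply: ler_sum => i _.
by rewrite [leRHS](bigD1 i) //= lerDl sumr_ge0 // => j _; apply: sqr_ge0.
Qed.

Lemma l2normE q (v : 'cV[C]_q) : l2norm v = Num.sqrt (hs v).
Proof. by congr Num.sqrt; apply: eq_bigr => i _; rewrite big_ord1. Qed.

Lemma l2norm_le1 q (v : 'cV[C]_q) : (l2norm v <= 1) = (hs v <= 1).
Proof. by rewrite l2normE -[X in _ <= X]sqrtr1 ler_sqrt. Qed.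

Lemma opnorm_bound p q (A : 'M[C]_(p, q)) (v : 'cV[C]_q) :
  l2norm v <= 1 -> l2norm (A *m v) <= opnorm A.
Proof.
move=> hv; apply: ub_le_sup; last by exists v.
(* The Hilbert-Schmidt norm of [A] bounds the set whose supremum is [opnorm A]. *)
exists (Num.sqrt (hs A)) => _ [w /= hw <-].
rewrite l2normE ler_sqrt ?hs_ge0 //; apply: le_trans (hs_mul _ _) _.
by rewrite ler_piMr ?hs_ge0 // -l2norm_le1.
Qed.

Lemma opnorm_ge0 p q (A : 'M[C]_(p, q)) : 0 <= opnorm A.
Proof.
have h0 : l2norm (0 : 'cV[C]_q) <= 1 by rewrite l2norm_le1 hs0.
by apply: le_trans _ (opnorm_bound A h0); rewrite l2normE sqrtr_ge0.
Qed.

(** The operator norm inequality on each column of [B], summed; a nonzero column is first normalized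
    to length 1. *)
Lemma opnorm_hs p q (A : 'M[C]_(p, q)) d (B : 'M[C]_(q, d)) :
  hs (A *m B) <= opnorm A ^+ 2 * hs B.
Proof.
rewrite (hs_cols B) (hs_cols (A *m B)) big_distrr; apply: ler_sum => j _ /=.
rewrite colE -mulmxA -colE; move: (col j B) => v {B}.
have [/eqP h0|hv] := boolP (hs v == 0).
  by rewrite h0 mulr0; apply: le_trans (hs_mul _ _) _; rewrite h0 mulr0.
have hv0 : 0 < hs v by rewrite lt0r hv hs_ge0.
pose s := (Num.sqrt (hs v))^-1.
have hs2 : normc s%:C ^+ 2 = (hs v)^-1.
  by rewrite normc_real_sqr exprVn sqr_sqrtr ?hs_ge0.
have := @opnorm_bound _ _ A (s%:C *: v).
rewrite l2norm_le1 hsZ hs2 mulVf // => /(_ (lexx _)).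
rewrite l2normE -scalemxAr hsZ hs2 => h.
rewrite -ler_pdivrMr // mulrC -[leLHS]sqr_sqrtr ?mulr_ge0 ?invr_ge0 ?hs_ge0 //.
by rewrite ler_sqr ?nnegrE ?sqrtr_ge0 ?opnorm_ge0.
Qed.

Lemma opnorm_le p q (A : 'M[C]_(p, q)) (c : R) : 0 <= c ->
  (forall v : 'cV[C]_q, hs (A *m v) <= c ^+ 2 * hs v) -> opnorm A <= c.
Proof.
move=> c0 h; apply: ge_sup.
  by exists (l2norm (A *m 0)); exists 0; rewrite //= l2norm_le1 hs0.
move=> _ [v /= hv <-]; rewrite l2normE -(ger0_norm c0) -sqrtr_sqr ler_sqrt
  ?sqr_ge0 //.
apply: le_trans (h v) _; rewrite ler_piMr ?sqr_ge0 //.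
by rewrite -l2norm_le1.
Qed.

Lemma matnorm_ge0 p q (E : {vspace 'M[C]_(p, q)}) m (x : 'M[subvs_of E]_m) :
  0 <= matnorm x.
Proof. exact: opnorm_ge0. Qed.

(** The test entries [g j] may have any width [d]: vectors, adjoints of elements of a span and
    identity matrices all serve below. *)
Lemma matnorm_hs p q (E : {vspace 'M[C]_(p, q)}) m (x : 'M[subvs_of E]_m) d
    (g : 'I_m -> 'M[C]_(q, d)) :
  \sum_i hs (\sum_j vsval (x i j) *m g j) <= matnorm x ^+ 2 * \sum_j hs (g j).
Proof.
have := opnorm_hs (block x) (\mxcol_j g j).
by rewrite /block mul_mxblock_mxrow !hs_mxcol.
Qed.

Lemma matnorm_le p q (E : {vspace 'M[C]_(p, q)}) m
    (x : 'M[subvs_of E]_m) (c : R) :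
  0 <= c ->
  (forall g : 'I_m -> 'cV[C]_q, \sum_i hs (\sum_j vsval (x i j) *m g j) <=
     c ^+ 2 * \sum_j hs (g j)) ->
  matnorm x <= c.
Proof.
move=> c0 h; apply: opnorm_le => // v.
rewrite -(submxcolK v) /block mul_mxblock_mxrow !hs_mxcol.
exact: h.
Qed.

End HilbertSchmidt.

(** * Homogeneity of the matrix norms, and bounds on the completely bounded norm *)

Section NormEstimates.
Variable R : realType.
Local Notation C := R[i].

Lemma opnormZ_le p q (a : R) (A : 'M[C]_(p, q)) : 0 <= a ->
  opnorm (a%:C *: A) <= a * opnorm A.
Proof.
move=> a0; apply: opnorm_le; first by rewrite mulr_ge0 ?opnorm_ge0.
move=> v; rewrite -scalemxAl hsZ normc_real_sqr exprMn -[leRHS]mulrA.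
by rewrite ler_wpM2l ?sqr_ge0 // opnorm_hs.
Qed.

Lemma opnormZ p q (a : R) (A : 'M[C]_(p, q)) : 0 < a ->
  opnorm (a%:C *: A) = a * opnorm A.
Proof.
move=> a0; apply: le_anti; rewrite (opnormZ_le _ (ltW a0)) /=.
(* The reverse inequality comes from scaling back by a^-1. *)
have := @opnormZ_le _ _ a^-1 (a%:C *: A); rewrite invr_ge0 (ltW a0) => /(_ isT).
rewrite scalerA -rmorphM mulVf ?gt_eqF // rmorph1 scale1r.
by rewrite ler_pdivlMl.
Qed.

Lemma matnormZ p q (E : {vspace 'M[C]_(p, q)}) m (a : R)
    (x : 'M[subvs_of E]_m) :
  0 < a -> matnorm (map_mx ( *:%R a%:C) x) = a * matnorm x.
Proof.
move=> a0; rewrite /matnorm.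
have -> : block (map_mx ( *:%R a%:C) x) = a%:C *: block x.
  by apply/matrixP => i j; rewrite !mxE.
exact: opnormZ.
Qed.

Section Maps.
Variables (p q r s : nat).
Variables (E : {vspace 'M[C]_(p, q)}) (F : {vspace 'M[C]_(r, s)}).
Variable u : 'Hom(subvs_of E, subvs_of F).

Lemma cbnorm_le (c : R) :
  (forall m (x : 'M[subvs_of E]_m), matnorm (map_mx u x) <= c * matnorm x) ->
  0 <= c -> (cbnorm u <= c%:E)%E.
Proof.
move=> h c0; apply: ge_ereal_sup => _ [m /= _ <-].
apply: ge_ereal_sup => _ [x /= hx <-].
by rewrite lee_fin; apply: le_trans (h _ _) _; rewrite ler_piMr.
Qed.

(** Dividing [x] by [c] puts it in the unit ball, so a test element only needs an upper bound on its
    norm, not the exact value. *)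
Lemma cbnorm_ge m (x : 'M[subvs_of E]_m) (c : R) :
  (0 < m)%N -> 0 < c -> matnorm x <= c ->
  ((matnorm (map_mx u x) / c)%:E <= cbnorm u)%E.
Proof.
move=> m0 c0 hx; have ci : 0 < c^-1 by rewrite invr_gt0.
apply: le_ereal_sup_tmp; exists (ampnorm u m); first by exists m.
apply: le_ereal_sup_tmp.
exists (matnorm (map_mx u (map_mx ( *:%R c^-1%:C) x)))%:E.
  by exists (map_mx ( *:%R c^-1%:C) x);
    rewrite //= matnormZ // mulrC ler_pdivrMr ?mul1r.
have -> : map_mx u (map_mx ( *:%R c^-1%:C) x) =
  map_mx ( *:%R c^-1%:C) (map_mx u x).
  by apply/matrixP => i j; rewrite !mxE linearZ.
by rewrite matnormZ // mulrC.
Qed.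

(** Nonnegativity allows inequalities between extended reals to be multiplied; the zero 1 x 1 matrix
    is the test element. *)
Lemma cbnorm_ge0 : (0 <= cbnorm u)%E.
Proof.
have h0 : matnorm (0 : 'M[subvs_of E]_1) <= 1.
  apply: matnorm_le => [|g]; first exact: ler01.
  rewrite big1 => [|i _].
    by rewrite expr1n mul1r sumr_ge0 // => i _; apply: hs_ge0.
  by rewrite big1 ?hs0 // => j _; rewrite mxE linear0 mul0mx.
apply: (le_trans _ (cbnorm_ge (m := 1) isT ltr01 h0)).
by rewrite lee_fin divr1 matnorm_ge0.
Qed.

End Maps.
End NormEstimates.

(** * Trace-orthogonal families with scalar row and column sums *)

Section Systems.
Variables (R : realType) (n : nat).
Local Notation C := R[i].

(** For H_n^k the parameters [al], [ka], [N] are n - k + 1, k and 'C(n - 1, k - 1); for the row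
    space they are 1, n and 1. *)
Record hsystem p q (b : 'I_n -> 'M[C]_(p, q)) (al ka N : nat) : Prop :=
  HSystem {
    hsystem_adjl : \sum_i adjm (b i) *m b i = al%:R%:M;
    hsystem_adjr : \sum_i b i *m adjm (b i) = ka%:R%:M;
    hsystem_tr : forall i j, \tr (adjm (b i) *m b j) = N%:R *+ (i == j)
  }.

Definition hspan p q (b : 'I_n -> 'M[C]_(p, q)) : {vspace 'M[C]_(p, q)} :=
  <<[seq b i | i <- enum 'I_n]>>%VS.

(** On the span of the [b i] this is the i-th coordinate, by trace orthogonality; being given by a
    trace, it is linear on all matrices. *)
Definition coef p q (b : 'I_n -> 'M[C]_(p, q)) (N : nat) (i : 'I_n)
    (x : 'M[C]_(p, q)) : C := N%:R^-1 * \tr (adjm (b i) *m x).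

Section OneSystem.
Variables (p q : nat) (b : 'I_n -> 'M[C]_(p, q)) (al ka N : nat).
Hypothesis hb : hsystem b al ka N.
Hypothesis N0 : (0 < N)%N.

Lemma hspan_mem i : b i \in hspan b.
Proof. by apply: memv_span; apply: map_f; rewrite mem_enum. Qed.

Lemma hspan_comb_mem (a : 'I_n -> C) : \sum_i a i *: b i \in hspan b.
Proof. by apply: memv_suml => i _; rewrite memvZ ?hspan_mem. Qed.

Lemma coef_is_linear i : linear (coef b N i).
Proof.
move=> a x y; rewrite /coef linearP /= linearP /= mulrDr; congr (_ + _).
by rewrite mulrCA.
Qed.

Lemma coef_comb (a : 'I_n -> C) i : coef b N i (\sum_j a j *: b j) = a i.
Proof.
rewrite /coef mulmx_sumr raddf_sum /= (bigD1 i) //= big1 ?addr0.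
  rewrite -scalemxAr linearZ /= (hsystem_tr hb) eqxx mulrCA mulVf ?mulr1 //.
  by rewrite pnatr_eq0 -lt0n.
by move=> j ji; rewrite -scalemxAr linearZ /= (hsystem_tr hb) eq_sym
  (negbTE ji) mulr0.
Qed.

Lemma hspan_coef x : x \in hspan b -> x = \sum_i coef b N i x *: b i.
Proof.
(* Membership in the span supplies some coefficients; [coef_comb] then identifies them with
   [coef]. *)
move=> hx; have /coord_span hx' : x \in <<[tuple b i | i < n]>>%VS by [].
have e : x = \sum_i coord [tuple b i | i < n] i x *: b i.
  by rewrite {1}hx'; apply: eq_bigr => i _; rewrite -tnth_nth tnth_mktuple.
rewrite {1}e; apply: eq_bigr => i _; congr (_ *: _).
by rewrite {2}e coef_comb.
Qed.

Lemma tr_comb (a a' : 'I_n -> C) :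
  \tr ((\sum_t a t *: b t) *m adjm (\sum_t a' t *: b t)) =
  N%:R * \sum_t a t * Num.conj (a' t).
Proof.
rewrite mulmx_suml raddf_sum mulr_sumr /=; apply: eq_bigr => t _.
rewrite -scalemxAl linearZ /= mxtrace_mulC adjm_sum mulmx_suml raddf_sum /=.
rewrite (bigD1 t) //= big1 ?addr0 => [|j jt].
  rewrite adjmZ -scalemxAl linearZ /= (hsystem_tr hb) eqxx.
  by rewrite [LHS]mulrA [LHS]mulrC.
by rewrite adjmZ -scalemxAl linearZ /= (hsystem_tr hb) (negbTE jt) mulr0.
Qed.

Lemma hs_comb (a : 'I_n -> C) :
  hs (\sum_t a t *: b t) = N%:R * \sum_t normc (a t) ^+ 2.
Proof.
apply: (@complexI R); rewrite rmorphM /= rmorph_nat hsE mxtrace_mulC tr_comb.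
congr (_ * _); rewrite rmorph_sum; apply: eq_bigr => t _.
by rewrite /= normc_sqr mulrC.
Qed.

(** The column of the [b i] is sqrt [al] times an isometry. *)
Lemma sum_hs_mul d (g : 'M[C]_(q, d)) : \sum_i hs (b i *m g) = al%:R * hs g.
Proof.
apply: (@complexI R); rewrite rmorphM /= rmorph_nat rmorph_sum /=.
under eq_bigr do rewrite hsE adjm_mul mulmxA -(mulmxA (adjm g)).
rewrite -raddf_sum -mulmx_suml -mulmx_sumr (hsystem_adjl hb).
by rewrite mul_mx_scalar -scalemxAl /= mxtraceZ hsE.
Qed.

Lemma hs_row d (g : 'I_n -> 'M[C]_(q, d)) : (0 < ka)%N ->
  hs (\sum_i b i *m g i) <= ka%:R * \sum_i hs (g i).
Proof.
move=> ka0; set y := \sum_i _.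
(* The sum of the [hs (g i - ka^-1 b_i^* y)] is nonnegative; expand it. *)
have kR : 0 < ka%:R :> R by rewrite ltr0n.
have kC : ka%:R != 0 :> C by rewrite pnatr_eq0 -lt0n.
suff e : \sum_i hs (g i - ka%:R^-1 *: (adjm (b i) *m y)) =
    \sum_i hs (g i) - ka%:R^-1 * hs y.
  rewrite -ler_pdivrMl // -subr_ge0 -e.
  by apply: sumr_ge0 => i _; apply: hs_ge0.
have cross : \sum_i \tr (adjm (g i) *m (adjm (b i) *m y)) = (hs y)%:C.
  rewrite hsE {2}/y adjm_sum mulmx_suml raddf_sum; apply: eq_bigr => i _ /=.
  by rewrite adjm_mul mulmxA.
have crossC : \sum_i \tr (adjm (adjm (b i) *m y) *m g i) = (hs y)%:C.
  rewrite hsE {3}/y mulmx_sumr raddf_sum; apply: eq_bigr => i _ /=.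
  by rewrite adjm_mul adjmK mulmxA.
have square : \sum_i hs (adjm (b i) *m y) = ka%:R * hs y.
  apply: (@complexI R); rewrite rmorphM /= rmorph_nat rmorph_sum /=.
  under eq_bigr do rewrite hsE adjm_mul adjmK mulmxA -(mulmxA (adjm y)).
  rewrite -raddf_sum -mulmx_suml -mulmx_sumr (hsystem_adjr hb).
  by rewrite mul_mx_scalar -scalemxAl /= mxtraceZ hsE.
have kconj : Num.conj (ka%:R^-1 : C) = ka%:R^-1 by rewrite fmorphV /= conjC_nat.
apply: (@complexI R).
have -> : (\sum_i hs (g i) - ka%:R^-1 * hs y)%:C =
    (\sum_i hs (g i))%:C - ka%:R^-1 * (hs y)%:C - ka%:R^-1 * (hs y)%:C
    + ka%:R^-1 * ka%:R^-1 * (ka%:R * hs y)%:C.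
  rewrite rmorphB !rmorphM /= fmorphV !rmorph_nat -mulrA.
  rewrite [_^-1 * (_ * (hs y)%:C)]mulrA.
  by rewrite mulVf // mul1r; ring.
rewrite -square -{1}cross -crossC !rmorph_sum /= !mulr_sumr -!sumrB.
rewrite -big_split /=.
apply: eq_bigr => i _; rewrite !hsE adjmD adjmN adjmZ kconj.
rewrite mulmxDl !mulmxDr !mulNmx !mulmxN -!scalemxAl -!scalemxAr.
by rewrite !raddfD !raddfN /= !mxtraceZ raddfN /=; ring.
Qed.

(** Trace of the identity sum b_i^* b_i = al, computed in two ways. This count and the next one
    eliminate the dimensions [q] and [p] from the final constants. *)
Lemma hsystem_countl : (n * N = al * q)%N.
Proof.
apply/eqP; rewrite -(eqr_nat C) !natrM; apply/eqP.
have := congr1 (fun A => \tr A) (hsystem_adjl hb).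
rewrite raddf_sum /= mxtrace_scalar -[RHS]mulr_natr => <-.
by under eq_bigr do rewrite (hsystem_tr hb) eqxx;
  rewrite sumr_const card_ord mulr_natl.
Qed.

Lemma hsystem_countr : (n * N = ka * p)%N.
Proof.
apply/eqP; rewrite -(eqr_nat C) !natrM; apply/eqP.
have := congr1 (fun A => \tr A) (hsystem_adjr hb).
rewrite raddf_sum /= mxtrace_scalar -[RHS]mulr_natr => <-.
by under eq_bigr do rewrite mxtrace_mulC (hsystem_tr hb) eqxx;
  rewrite sumr_const card_ord mulr_natl.
Qed.

End OneSystem.
End Systems.

(** * Comparison of matrix norms over a general system and over a row system *)

Section TwoSystems.
Variables (R : realType) (n : nat).
Local Notation C := R[i].
Variables (p q s : nat) (b : 'I_n -> 'M[C]_(p, q)) (c : 'I_n -> 'M[C]_(1, s)).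
Variables (al ka N : nat).
Hypothesis hb : hsystem b al ka N.
Hypothesis hc : hsystem c 1 n 1.
Hypothesis N0 : (0 < N)%N.

(** The product is 1 x 1, hence determined by its trace. *)
Lemma row_orthonormal i j : c i *m adjm (c j) = (i == j)%:R%:M.
Proof.
rewrite [LHS]mx11_scalar; congr (_%:M).
by rewrite -trace_mx11 mxtrace_mulC (hsystem_tr hc) eq_sym.
Qed.

Section SameCoefficients.
Variables (m : nat).
Variables (x : 'M[subvs_of (hspan b)]_m) (y : 'M[subvs_of (hspan c)]_m).
Variable a : 'I_m -> 'I_m -> 'I_n -> C.
Hypothesis hx : forall i j, vsval (x i j) = \sum_t a i j t *: b t.
Hypothesis hy : forall i j, vsval (y i j) = \sum_t a i j t *: c t.

(** The trace recovers each entry of [y] applied to [f] from [x] applied to a suitable [g], and |tr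
    Z|^2 is at most p times the squared Hilbert-Schmidt norm of Z. *)
Lemma matnorm_row_le : matnorm y <= Num.sqrt (p%:R / N%:R) * matnorm x.
Proof.
have NR : 0 < N%:R :> R by rewrite ltr0n.
apply: matnorm_le => [|f]; first by rewrite mulr_ge0 ?sqrtr_ge0 ?matnorm_ge0.
(* The numbers [h j t] are the coordinates of [f j] seen by the row system. The conjugation in [g j]
   is undone by the adjoint, so that pairing with sum_t a_t b_t under the trace gives N sum_t a_t
   h_t. *)
pose h j t : C := (c t *m f j) 0 0.
pose g j := adjm (\sum_t Num.conj (h j t) *: b t).
have hsg j : hs (g j) = N%:R * hs (f j).
  rewrite hs_adj (hs_comb hb); congr (_ * _).
  rewrite -[RHS]mul1r -(sum_hs_mul hc); apply: eq_bigr => t _.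
  rewrite /hs !big_ord1 /h.
  by apply: (@complexI R); rewrite !normc_sqr conjCK mulrC.
have trZ i : \tr (\sum_j vsval (x i j) *m g j) =
    N%:R * (\sum_j vsval (y i j) *m f j) 0 0.
  rewrite raddf_sum summxE mulr_sumr; apply: eq_bigr => j _ /=.
  rewrite hx (tr_comb hb) hy mulmx_suml summxE; congr (_ * _).
  by apply: eq_bigr => t _; rewrite conjCK -scalemxAl mxE.
have hsZ i : N%:R ^+ 2 * hs (\sum_j vsval (y i j) *m f j) <=
    p%:R * hs (\sum_j vsval (x i j) *m g j).
  apply: le_trans _ (normc_trace _); rewrite trZ /hs !big_ord1 normcM exprMn.
  by rewrite -(rmorph_nat (real_complex R)) normc_real_sqr.
have := matnorm_hs x g; under [X in _ <= _ * X]eq_bigr do rewrite hsg.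
rewrite -mulr_sumr => hX.
rewrite exprMn sqr_sqrtr ?divr_ge0 ?ler0n //.
have N2 : 0 < N%:R ^+ 2 :> R by rewrite exprn_gt0.
rewrite -(ler_pM2l N2).
have -> : N%:R ^+ 2 * (p%:R / N%:R * matnorm x ^+ 2 * \sum_j hs (f j)) =
    p%:R * (matnorm x ^+ 2 * (N%:R * \sum_j hs (f j))) by field; rewrite gt_eqF.
rewrite mulr_sumr; apply: le_trans (_ :
  \sum_i p%:R * hs (\sum_j vsval (x i j) *m g j) <= _).
  by apply: ler_sum => i _; apply: hsZ.
by rewrite -mulr_sumr ler_wpM2l ?ler0n.
Qed.

Lemma matnorm_from_row_le : matnorm x <= Num.sqrt al%:R * matnorm y.
Proof.
apply: matnorm_le => [|g]; first by rewrite mulr_ge0 ?sqrtr_ge0 ?matnorm_ge0.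
pose h j t := b t *m g j.
(* All vectors [b t *m g j], written as rows, are packed into one matrix from which [c t] extracts
   the t-th. Thus [y] applied to [f] is the transpose of [x] applied to [g]. *)
pose f j := \sum_t adjm (c t) *m (h j t)^T.
have cf t j : c t *m f j = (h j t)^T.
  rewrite /f mulmx_sumr (bigD1 t) //= big1 ?addr0.
    by rewrite mulmxA row_orthonormal eqxx mul1mx.
  by move=> t' tt'; rewrite mulmxA row_orthonormal eq_sym (negbTE tt') raddf0
    mul0mx.
have hsf j : hs (f j) = al%:R * hs (g j).
  rewrite -(sum_hs_mul hb); apply: (@complexI R);
    rewrite hsE {1}/f adjm_sum mulmx_suml raddf_sum rmorph_sum.
  apply: eq_bigr => t _ /=; rewrite adjm_mul adjmK -mulmxA cf -hsE.
  by rewrite hs_tr.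
have := matnorm_hs y f; under [X in _ <= _ * X]eq_bigr do rewrite hsf.
rewrite -mulr_sumr => hY.
rewrite exprMn sqr_sqrtr ?ler0n // -mulrA mulrCA; apply: le_trans _ hY.
apply: ler_sum => i _; rewrite -hs_tr raddf_sum /=.
have e : \sum_j (vsval (x i j) *m g j)^T = \sum_j vsval (y i j) *m f j.
  apply: eq_bigr => j _; rewrite hx hy !mulmx_suml raddf_sum;
    apply: eq_bigr => t _ /=.
  by rewrite -!scalemxAl linearZ /= cf.
by rewrite e.
Qed.

End SameCoefficients.
End TwoSystems.

(** * The linear map between two spans that carries each b_t to c_t *)

Section Transport.
Variables (R : realType) (n : nat).
Local Notation C := R[i].
Variables (p q r s : nat) (b : 'I_n -> 'M[C]_(p, q)) (N : nat).
Variable c : 'I_n -> 'M[C]_(r, s).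

Definition transport (x : subvs_of (hspan b)) : subvs_of (hspan c) :=
  vsproj (hspan c) (\sum_t coef b N t (vsval x) *: c t).

Lemma transport_is_linear : linear transport.
Proof.
move=> a x y; rewrite /transport -linearP; congr (vsproj _ _).
rewrite scaler_sumr -big_split; apply: eq_bigr => t _ /=.
by rewrite coef_is_linear scalerDl [in RHS]scalerA.
Qed.

HB.instance Definition _ :=
  GRing.isSemilinear.Build C (subvs_of (hspan b)) (subvs_of (hspan c)) _
    transport (GRing.semilinear_linear transport_is_linear).

Lemma vsval_transport x :
  vsval (linfun transport x) = \sum_t coef b N t (vsval x) *: c t.
Proof. by rewrite lfunE vsprojK // hspan_comb_mem. Qed.

End Transport.

(** * Upper and lower bounds for the distance to a row system *)

Section Distance.
Variables (R : realType) (n : nat).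
Local Notation C := R[i].
Variables (p q s : nat) (b : 'I_n -> 'M[C]_(p, q)) (c : 'I_n -> 'M[C]_(1, s)).
Variables (al ka N : nat).
Hypothesis hb : hsystem b al ka N.
Hypothesis hc : hsystem c 1 n 1.
Hypothesis N0 : (0 < N)%N.
Hypothesis n0 : (0 < n)%N.

Let ka0 : (0 < ka)%N.
Proof.
have := muln_gt0 n N; rewrite n0 N0 (hsystem_countr hb) muln_gt0.
by case: ka.
Qed.

Let q0 : (0 < q)%N.
Proof.
have := muln_gt0 n N; rewrite n0 N0 (hsystem_countl hb) muln_gt0.
by case: q; rewrite ?andbF.
Qed.

Let E := hspan b.
Let F := hspan c.

Lemma dcb_row_le : (dcb E F <= (Num.sqrt (al%:R * n%:R / ka%:R))%:E)%E.
Proof.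
(* [u] sends b_t to c_t and [v] sends c_t to b_t; the constants [N] and 1 are the square norms of
   the respective source families. *)
pose u := linfun (transport (b := b) N c).
pose v := linfun (transport (b := c) 1 b).
have uE x : vsval (u x) = \sum_t coef b N t (vsval x) *: c t.
  exact: vsval_transport.
have vE x : vsval (v x) = \sum_t coef c 1 t (vsval x) *: b t.
  exact: vsval_transport.
have u_le : (cbnorm u <= (Num.sqrt (p%:R / N%:R))%:E)%E.
  apply: cbnorm_le => [m x|]; last exact: sqrtr_ge0.
  apply: (matnorm_row_le hb hc N0
    (a := fun i j t => coef b N t (vsval (x i j)))) => i j.
    by rewrite -(hspan_coef hb) // subvsP.
  by rewrite mxE uE.
have v_le : (cbnorm v <= (Num.sqrt al%:R)%:E)%E.
  apply: cbnorm_le => [m x|]; last exact: sqrtr_ge0.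
  apply: (matnorm_from_row_le hb hc
    (a := fun i j t => coef c 1 t (vsval (x i j)))) => i j.
    by rewrite mxE vE.
  by rewrite -(hspan_coef hc) // subvsP.
apply: ge_ereal_inf; exists (cbnorm u * cbnorm v)%E.
  exists u, v; split=> //; split.
  - move=> x; apply: val_inj; rewrite /= vE uE.
    rewrite [RHS](hspan_coef hb) ?subvsP //; apply: eq_bigr => t _.
    by rewrite (coef_comb hc).
  - move=> x; apply: val_inj; rewrite /= uE vE.
    rewrite [RHS](hspan_coef hc) ?subvsP //; apply: eq_bigr => t _.
    by rewrite (coef_comb hb).
  - by apply: (le_lt_trans u_le); rewrite ltry.
  - by apply: (le_lt_trans v_le); rewrite ltry.
apply: le_trans (lee_pmul (cbnorm_ge0 u) (cbnorm_ge0 v) u_le v_le) _.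
rewrite -EFinM lee_fin -sqrtrM ?divr_ge0 ?ler0n //.
(* The count n N = ka p turns p / N into n / ka. *)
have -> // : p%:R / N%:R * al%:R = al%:R * n%:R / ka%:R :> R.
have := congr1 (fun k => k%:R : R) (hsystem_countr hb); rewrite !natrM => e.
have NR : N%:R != 0 :> R by rewrite pnatr_eq0 -lt0n.
have kR : ka%:R != 0 :> R by rewrite pnatr_eq0 -lt0n.
have -> : p%:R = n%:R * N%:R / ka%:R :> R by rewrite e mulrC mulKf.
by field; rewrite NR kR.
Qed.

Lemma dcb_row_ge : ((Num.sqrt (al%:R * n%:R / ka%:R))%:E <= dcb E F)%E.
Proof.
apply: le_ereal_inf_tmp => _ [u [v [[uK vK _ _] ->]]].
pose sb i : subvs_of E := vsproj E (b i).
pose sc i : subvs_of F := vsproj F (c i).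
have sbE i : vsval (sb i) = b i by rewrite vsprojK // hspan_mem.
have scE i : vsval (sc i) = c i by rewrite vsprojK // hspan_mem.
(* Matrix norms are taken on square matrices, so the test row and the test column are placed in row
   or column [i0] of an n x n matrix padded with zeros. *)
pose i0 := Ordinal n0.
pose SU := \sum_j hs (vsval (u (sb j))).
pose SV := \sum_j hs (vsval (v (sc j))).
have SU0 : 0 <= SU by apply: sumr_ge0 => i _; apply: hs_ge0.
have SV0 : 0 <= SV by apply: sumr_ge0 => i _; apply: hs_ge0.
have kR : 0 < ka%:R :> R by rewrite ltr0n.
have qR : 0 < q%:R :> R by rewrite ltr0n.
have u_ge : ((Num.sqrt (SU / ka%:R))%:E <= cbnorm u)%E.
  pose x : 'M[subvs_of E]_n := \matrix_(i, j) if i == i0 then sb j else 0.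
  have hx : matnorm x <= Num.sqrt ka%:R.
    apply: matnorm_le => [|g]; first exact: sqrtr_ge0.
    rewrite sqr_sqrtr ?ler0n // (bigD1 i0) //= [X in _ + X]big1 ?addr0.
      under eq_bigr do rewrite mxE eqxx sbE.
      exact: (hs_row hb).
    move=> i ii0; rewrite big1 ?hs0 // => j _.
    by rewrite mxE (negbTE ii0) linear0 mul0mx.
  have sk : 0 < Num.sqrt ka%:R :> R by rewrite sqrtr_gt0.
  apply: (le_trans _ (cbnorm_ge u n0 sk hx)); rewrite lee_fin.
  rewrite sqrtrM // sqrtrV ?ler0n // ler_pM2r ?invr_gt0 //.
  (* Testing the row of the u(b_j) on its own adjoint gives the scalar [SU], while the test vector
     has squared norm [SU]. One factor then cancels unless [SU] is 0. *)
  have := matnorm_hs (map_mx u x) (fun j => adjm (vsval (u (sb j)))).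
  under [X in _ <= _ * X]eq_bigr do rewrite hs_adj.
  rewrite (bigD1 i0) //= => hM.
  have : SU ^+ 2 <= matnorm (map_mx u x) ^+ 2 * SU.
    apply: le_trans _ hM; rewrite -[leLHS]addr0 lerD //; last first.
      by apply: sumr_ge0 => i _; apply: hs_ge0.
    under eq_bigr do rewrite !mxE eqxx.
    have -> : \sum_j vsval (u (sb j)) *m adjm (vsval (u (sb j))) = (SU%:C)%:M.
      rewrite rmorph_sum raddf_sum /=; apply: eq_bigr => j _.
      by rewrite [LHS]mx11_scalar -trace_mx11 mxtrace_mulC -hsE.
    by rewrite /hs !big_ord1 mxE eqxx normc_real_sqr.
  have [->|SUn] := eqVneq SU 0; first by rewrite sqrtr0 matnorm_ge0.
  rewrite expr2 ler_pM2r ?lt0r ?SUn // => h.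
  by rewrite -(ger0_norm (matnorm_ge0 _)) -sqrtr_sqr ler_sqrt ?sqr_ge0.
have v_ge : ((Num.sqrt (SV / q%:R))%:E <= cbnorm v)%E.
  pose y : 'M[subvs_of F]_n := \matrix_(i, j) if j == i0 then sc i else 0.
  have hy : matnorm y <= 1.
    apply: matnorm_le => [|f]; first exact: ler01.
    have e i : \sum_j vsval (y i j) *m f j = c i *m f i0.
      rewrite (bigD1 i0) //= [X in _ + X]big1 ?addr0 ?mxE ?eqxx ?scE //.
      by move=> j ji0; rewrite mxE (negbTE ji0) linear0 mul0mx.
    under eq_bigr do rewrite e.
    rewrite (sum_hs_mul hc) expr1n !mul1r (bigD1 i0) //= lerDl.
    by apply: sumr_ge0 => i _; apply: hs_ge0.
  apply: (le_trans _ (cbnorm_ge v n0 ltr01 hy)); rewrite lee_fin divr1.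
  (* The identity of size q in slot [i0] has squared Hilbert-Schmidt norm q and is sent to the
     column of the v(c_i), of squared norm [SV]. *)
  have := matnorm_hs (map_mx v y) (fun j => if j == i0 then 1%:M else 0).
  have -> : \sum_j hs (if j == i0 then 1%:M else 0 : 'M[C]_q) = q%:R.
    rewrite (bigD1 i0) //= [X in _ + X]big1 ?addr0 ?eqxx.
      apply: (@complexI R); rewrite hsE mulmx1 rmorph_nat /mxtrace.
      under eq_bigr do rewrite !mxE eqxx conjC1.
      by rewrite sumr_const card_ord.
    by move=> j /negbTE ->; rewrite hs0.
  have e i : \sum_j vsval (map_mx v y i j) *m
      (if j == i0 then 1%:M else 0 : 'M[C]_q) = vsval (v (sc i)).
    rewrite (bigD1 i0) //= [X in _ + X]big1 ?addr0 ?mxE ?eqxx ?mulmx1 //.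
    by move=> j /negbTE ->; rewrite mulmx0.
  under eq_bigr do rewrite e.
  rewrite -ler_pdivrMr // => h.
  by rewrite -(ger0_norm (matnorm_ge0 _)) -sqrtr_sqr ler_sqrt ?sqr_ge0.
(* [SU] is the squared Hilbert-Schmidt norm of [U], and [SV] is N times that of [V]. Since v(u(b_j))
   = b_j, each diagonal entry of V U is 1, so its trace is n and Cauchy-Schwarz applies. *)
have prod_ge : n%:R ^+ 2 * N%:R <= SU * SV.
  pose U i j := coef c 1 i (vsval (u (sb j))).
  pose V j i := coef b N j (vsval (v (sc i))).
  have uE j : vsval (u (sb j)) = \sum_i U i j *: c i.
    by apply: (hspan_coef hc) => //; exact: subvsP.
  have vE i : vsval (v (sc i)) = \sum_j V j i *: b j.
    by apply: (hspan_coef hb) => //; exact: subvsP.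
  have UV j : \sum_i U i j * V j i = 1.
    have e : u (sb j) = \sum_i U i j *: sc i.
      apply: val_inj; rewrite /= uE raddf_sum; apply: eq_bigr => i _.
      by rewrite -scE.
    have e2 : vsval (v (u (sb j))) = \sum_l (\sum_i U i j * V l i) *: b l.
      under [RHS]eq_bigr do rewrite scaler_suml.
      rewrite exchange_big /= e linear_sum raddf_sum; apply: eq_bigr => i _ /=.
      rewrite linearZ /= vE scaler_sumr; apply: eq_bigr => l _.
      by rewrite scalerA.
    have := congr1 (coef b N j) e2; rewrite (coef_comb hb) // => <-.
    rewrite uK sbE /coef (hsystem_tr hb) eqxx mulVf //.
    by rewrite pnatr_eq0 -lt0n.
  have hSU : SU = \sum_(ij : 'I_n * 'I_n) normc (U ij.1 ij.2) ^+ 2.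
    rewrite -(pair_bigA _ (fun i j => normc (U i j) ^+ 2)) exchange_big.
    by apply: eq_bigr => j _; rewrite uE (hs_comb hc) mul1r.
  have hSV : SV = N%:R * \sum_(ij : 'I_n * 'I_n) normc (V ij.2 ij.1) ^+ 2.
    rewrite -(pair_bigA _ (fun i j => normc (V j i) ^+ 2)) mulr_sumr.
    by apply: eq_bigr => i _; rewrite vE (hs_comb hb).
  rewrite hSU hSV mulrCA mulrC ler_wpM2l ?ler0n //.
  apply: le_trans _ (normc_sum_CauchySchwarz _ _).
  rewrite -(pair_bigA _ (fun i j => U i j * V j i)) exchange_big /=.
  under eq_bigr do rewrite UV.
  by rewrite sumr_const card_ord -(rmorph_nat (real_complex R)) normc_real_sqr.
apply: le_trans (lee_pmul _ _ u_ge v_ge); rewrite ?lee_fin ?sqrtr_ge0 //.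
rewrite -sqrtrM ?divr_ge0 ?ler0n // ler_sqrt ?mulr_ge0 ?invr_ge0 ?ler0n //.
rewrite mulrACA -invfM ler_pdivlMr ?mulr_gt0 //.
apply: le_trans _ prod_ge.
(* The count n N = al q makes n^2 N / (ka q) equal to al n / ka. *)
have := congr1 (fun k => k%:R : R) (hsystem_countl hb); rewrite !natrM => e.
rewrite le_eqVlt; apply/orP; left; apply/eqP.
have -> : n%:R ^+ 2 * N%:R = n%:R * (al%:R * q%:R) :> R by rewrite -e mulrA.
by field; rewrite gt_eqF.
Qed.

End Distance.

(** * Counting the partitions of the index set into I, a point i, and J *)

Section Subsets.
Variable n : nat.

Lemma mem_subsets m (A : {set 'I_n}) : (A \in subsets n m) = (#|A| == m).
Proof. by rewrite mem_sort mem_enum inE. Qed.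

Lemma size_subsets m : size (subsets n m) = 'C(n, m).
Proof. by rewrite size_sort -cardE card_draws card_ord. Qed.

Lemma card_subset_at m (a : 'I_('C(n, m))) : #|subset_at a| = m.
Proof. by apply/eqP; rewrite -mem_subsets mem_nth // size_subsets. Qed.

Lemma subset_at_inj m : injective (@subset_at n m).
Proof.
move=> a a' /eqP; rewrite nth_uniq ?size_subsets //;
  first by move=> /eqP /val_inj.
by rewrite sort_uniq enum_uniq.
Qed.

Lemma big_subset_at (V : nmodType) m (f : {set 'I_n} -> V) :
  \sum_(a < 'C(n, m)) f (subset_at a) = \sum_(A : {set 'I_n} | #|A| == m) f A.
Proof.
transitivity (\sum_(A <- subsets n m) f A).
  by rewrite (big_nth finset.set0) size_subsets big_mkord.
rewrite (perm_big (enum [set A : {set 'I_n} | #|A| == m]%SET));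
  last exact/permPl/perm_sort.
by rewrite big_enum; apply: eq_bigl => A; rewrite inE.
Qed.

(** The summation condition of [bmx]: I, {i} and J partition ['I_n]. *)
Definition splits (I : {set 'I_n}) (i : 'I_n) (J : {set 'I_n}) : bool :=
  ((I :&: J == finset.set0) && (~: (I :|: J) == [set i]))%SET.

Lemma splitsE I i J : splits I i J = (i \notin I) && (J == ~: (i |: I))%SET.
Proof.
apply/andP/andP => [[/eqP IJ /eqP IJi]|[iI /eqP ->]].
  have := finset.in_set1 i i; rewrite -IJi eqxx !inE negb_or => /andP[iI iJ].
  split=> //; apply/eqP/setP => x; rewrite !inE negb_or.
  have := finset.in_set0 x; rewrite -IJ inE.
  by case: (x \in I); case: (x \in J).
split; apply/eqP/setP => x; rewrite !inE.
  by case: (x \in I); rewrite ?orbT ?andbF.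
by case: eqP => [->|_]; [rewrite (negbTE iI) | case: (x \in I)].
Qed.

Lemma splitsC I i J : splits I i J = splits J i I.
Proof. by rewrite /splits finset.setIC finset.setUC. Qed.

Lemma splits_inj I i i' J : splits I i J -> splits I i' J -> i = i'.
Proof.
by move=> /andP[_ /eqP h] /andP[_]; rewrite h => /eqP/finset.set1_inj.
Qed.

(** I and i determine J as the complement of their union; the cardinality hypothesis makes that
    complement one of the enumerated sets of size m. *)
Lemma sum_splits (V : pzSemiRingType) m (I : {set 'I_n}) i :
  (#|I| + m).+1 = n ->
  \sum_(a < 'C(n, m)) (splits I i (subset_at a))%:R = (i \notin I)%:R :> V.
Proof.
move=> cI; rewrite (big_subset_at _ (fun J => (splits I i J)%:R)).
under eq_bigr do rewrite splitsE.
case: (boolP (i \in I)) => iI /=; first by rewrite big1.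
have cJ : #|~: (i |: I)%SET| = m.
  by rewrite cardsCs finset.setCK card_ord cardsU1 iI add1n -[X in (X - _)%N]cI
    -addSn addKn.
rewrite (bigD1 (~: (i |: I)))%SET ?cJ //= eqxx big1 ?addr0 //.
by move=> J /andP[_ /negbTE ->].
Qed.

Lemma sum_notin (V : pzSemiRingType) (A : {set 'I_n}) :
  \sum_i (i \notin A)%:R = (n - #|A|)%:R :> V.
Proof.
have -> : (n - #|A|)%N = #|~: A|%SET by rewrite [RHS]cardsCs
  finset.setCK card_ord.
rewrite -sum1_card natr_sum [RHS]big_mkcond /=; apply: eq_bigr => i _.
by rewrite inE; case: (i \in A).
Qed.

(** The sets avoiding i are the subsets of an (n - 1)-element set. This is the source of N = 'C(n -
    1, k - 1). *)
Lemma sum_card_notin (V : pzSemiRingType) m i :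
  \sum_(A : {set 'I_n} | #|A| == m) (i \notin A)%:R = 'C(n.-1, m)%:R :> V.
Proof.
have -> : n.-1 = #|[set~ i]%SET| by rewrite cardsC1 card_ord.
rewrite -cards_draws -sum1_card natr_sum big_mkcond [RHS]big_mkcond /=.
apply: eq_bigr => A _; rewrite inE finset.subsets_disjoint finset.setCK
  disjoint_sym.
by rewrite disjoints1 andbC; case: (#|A| == m); case: (i \in A).
Qed.

End Subsets.

(** * The generators of H_n^k form such a system *)

Section HomogeneousSystem.
Variables (R : realType) (n k : nat).
Hypothesis k_range : (1 <= k <= n)%N.
Local Notation C := R[i].

Let cards_sum : (k.-1 + (n - k)).+1 = n.
Proof. by case/andP: k_range => k1 kn; rewrite -addSn prednK // subnKC. Qed.

Let cards_sumC : (n - k + k.-1).+1 = n.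
Proof. by rewrite addnC. Qed.

Lemma bmxE (i : 'I_n) r c : bmx R k i r c =
  (-1) ^+ word_perm (subset_at c) i (subset_at r) *+
    splits (subset_at c) i (subset_at r).
Proof.
rewrite /bmx summxE (bigD1 c) //= [X in _ + X]big1 ?addr0 => [|c' cc'].
  rewrite summxE big_mkcond (bigD1 r) //= [X in _ + X]big1 ?addr0 => [|r' rr'].
    by rewrite -/(splits _ _ _); case: splits; rewrite ?mxE ?eqxx ?mulr1.
  by case: ifP => // _; rewrite !mxE eq_sym (negbTE rr') mulr0.
rewrite summxE big1 // => r' _.
by rewrite !mxE [c == _]eq_sym (negbTE cc') andbF mulr0.
Qed.

(** A sign times its conjugate is 1, so only the partition condition survives. *)
Lemma conj_bmx_mul (i : 'I_n) r c :
  Num.conj (bmx R k i r c) * bmx R k i r c =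
  (splits (subset_at c) i (subset_at r))%:R.
Proof.
rewrite bmxE; case: splits; last by rewrite mulr0.
by rewrite !mulr1n rmorph_sign -expr2 sqrr_sign.
Qed.

Lemma bmx_eq0 (i : 'I_n) r c :
  ~~ splits (subset_at c) i (subset_at r) -> bmx R k i r c = 0.
Proof. by rewrite bmxE => /negbTE ->. Qed.

(** Off the diagonal every term vanishes, as i and J determine I. On the diagonal the sum counts the
    i outside I, of which there are n - (k - 1). *)
Lemma bmx_adjl : \sum_(i < n) adjm (bmx R k i) *m bmx R k i = (n - k + 1)%:R%:M.
Proof.
apply/matrixP => c c'; rewrite summxE !mxE.
under eq_bigr do rewrite mxE; under eq_bigr do under eq_bigr do rewrite !mxE.
have [<-|cc'] := eqVneq c c'; last first.
  rewrite mulr0n big1 // => i _; rewrite big1 // => r _.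
  case: (boolP (splits (subset_at c) i (subset_at r))) => [h|/bmx_eq0 ->];
    last by rewrite rmorph0 mul0r.
  case: (boolP (splits (subset_at c') i (subset_at r))) => [h'|/bmx_eq0 ->];
    last by rewrite mulr0.
  move: h h'; rewrite !(splitsC _ _ (subset_at r)) !splitsE => /andP[_ /eqP h]
    /andP[_ /eqP h'].
  by case/eqP: cc'; apply: subset_at_inj; rewrite h h'.
under eq_bigr do under eq_bigr do rewrite conj_bmx_mul.
under eq_bigr do rewrite sum_splits ?card_subset_at //.
by rewrite sum_notin card_subset_at -[X in (X - k.-1)%N]cards_sum -addnS addKn
  addn1.
Qed.

(** The same argument with I and J exchanged: the i outside J number n - (n - k) = k. *)
Lemma bmx_adjr : \sum_(i < n) bmx R k i *m adjm (bmx R k i) = k%:R%:M.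
Proof.
apply/matrixP => r r'; rewrite summxE !mxE.
under eq_bigr do rewrite mxE; under eq_bigr do under eq_bigr do rewrite !mxE.
have [<-|rr'] := eqVneq r r'; last first.
  rewrite mulr0n big1 // => i _; rewrite big1 // => c _.
  case: (boolP (splits (subset_at c) i (subset_at r))) => [h|/bmx_eq0 ->];
    last by rewrite mul0r.
  case: (boolP (splits (subset_at c) i (subset_at r'))) => [h'|/bmx_eq0 ->];
    last by rewrite rmorph0 mulr0.
  move: h h'; rewrite !splitsE => /andP[_ /eqP h] /andP[_ /eqP h'].
  by case/eqP: rr'; apply: subset_at_inj; rewrite h h'.
under eq_bigr do under eq_bigr do rewrite mulrC conj_bmx_mul splitsC.
under eq_bigr do rewrite sum_splits ?card_subset_at //.
by rewrite sum_notin card_subset_at subKn //; case/andP: k_range.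
Qed.

(** I and J determine i, so distinct generators have disjoint supports; the square norm counts the
    sets I that avoid i. *)
Lemma bmx_tr (i j : 'I_n) :
  \tr (adjm (bmx R k i) *m bmx R k j) = ('C(n.-1, k.-1))%:R *+ (i == j).
Proof.
rewrite /mxtrace; under eq_bigr do rewrite mxE.
have [<-|ij] := eqVneq i j; last first.
  rewrite mulr0n big1 // => c _; rewrite big1 // => r _; rewrite !mxE.
  case: (boolP (splits (subset_at c) i (subset_at r))) => [h|/bmx_eq0 ->];
    last by rewrite rmorph0 mul0r.
  case: (boolP (splits (subset_at c) j (subset_at r))) => [h'|/bmx_eq0 ->];
    last by rewrite mulr0.
  by case/eqP: ij; apply: splits_inj h h'.
under eq_bigr do under eq_bigr do rewrite !mxE conj_bmx_mul.
under eq_bigr do rewrite sum_splits ?card_subset_at //.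
by rewrite (big_subset_at _ (fun A => (i \notin A)%:R)) sum_card_notin.
Qed.

Lemma bmx_hsystem : hsystem (@bmx n R k) (n - k + 1) k 'C(n.-1, k.-1).
Proof. by split; [exact: bmx_adjl | exact: bmx_adjr | exact: bmx_tr]. Qed.

End HomogeneousSystem.

Theorem corollary3p3 (R : realType) (n k : nat) (hk : (1 <= k)%N)
    (hkn : (k <= n)%N) :
  dcb (Hspace n R k) (Hspace n R n) =
  (Num.sqrt ((n - k + 1)%:R * n%:R / k%:R))%:E :> \bar R.
Proof.
have n0 : (0 < n)%N := leq_trans hk hkn.
have hb : hsystem (@bmx n R k) (n - k + 1) k 'C(n.-1, k.-1).
  by apply: bmx_hsystem; rewrite hk.
have N0 : (0 < 'C(n.-1, k.-1))%N by rewrite bin_gt0 -!subn1 leq_sub2r.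
have hc : hsystem (@bmx n R n) 1 n 1.
  have e : (n - n + 1)%N = 1%N by rewrite subnn.
  by rewrite -{1}e -[X in hsystem _ _ _ X](binn n.-1); apply: bmx_hsystem;
    rewrite n0 leqnn.
(* The generators of H_n^n have one row only up to this equation, so they are generalized to a
   family [c] before the dimension is rewritten. *)
have r1 : 'C(n, n - n) = 1%N by rewrite subnn bin0.
rewrite /Hspace; move: (@bmx n R n) hc; rewrite {}r1 => c hc.
apply/eqP; rewrite eq_le; apply/andP; split.
  exact: (dcb_row_le hb hc).
exact: (dcb_row_ge hb hc).
Qed.
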